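(* Let $\mathbf{k}$ be an algebraically closed field. If $\mathcal{C}$ is a finite tensor category over $\mathbf{k}$, then the set $\mathrm{Piv}(\mathcal{C})$ of pivotal structures on $\mathcal{C}$ is finite.
   Context: A tensor category over $\mathbf{k}$ means a $\mathbf{k}$-linear abelian rigid monoidal category $\mathcal{C}$ such that: the unit object $\mathbf{1} \in \mathcal{C}$ is simple; the tensor product $\otimes: \mathcal{C} \times \mathcal{C} \to \mathcal{C}$ is $\mathbf{k}$-linear in both variables; every object of $\mathcal{C}$ is of finite length; every hom-set in $\mathcal{C}$ is finite-dimensional over $\mathbf{k}$. A $\mathbf{k}$-linear abelian category is finite if it is $\mathbf{k}$-linearly equivalent to the category of finitely generated modules over a finite-dimensional $\mathbf{k}$-algebra; a finite tensor category is a tensor category that is finite in this sense. For a rigid monoidal category $\mathcal{C}$ with left duality functor $(-)^*$ (evaluation $V^* \otimes V \to \mathbf{1}$), the double dual $(-)^{**}: \mathcal{C} \to \mathcal{C}$ is a strong monoidal functor, and a pivotal structure on $\mathcal{C}$ is an element of $\mathrm{Piv}(\mathcal{C}) := \mathrm{Nat}_\otimes(\mathrm{id}_\mathcal{C}, (-)^{**})$, where $\mathrm{Nat}_\otimes(F,G)$ is the set of monoidal natural transformations $F \to G$, i.e. natural transformations compatible with the monoidal structure morphisms for both tensor products and unit objects. *)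

(* Defs.v *)
From HB Require Import structures.
From mathcomp Require Import all_boot all_algebra falgebra.
From mathcomp Require Import boolp.

Set Implicit Arguments.
Unset Strict Implicit.
Unset Printing Implicit Defensive.

Import GRing.Theory.
Local Open Scope ring_scope.

Declare Scope cat_scope.
Delimit Scope cat_scope with cat.
Local Open Scope cat_scope.

Reserved Notation "g \c f" (at level 40, left associativity).
Reserved Notation "X ⊗ Y" (at level 39, left associativity).
Reserved Notation "f ⊗m g" (at level 39, left associativity).

Definition fin_generated (R : pzRingType) (M : lmodType R) : Prop :=
  exists (n : nat) (g : 'I_n -> M),
    forall m : M, exists c : 'I_n -> R, m = \sum_(i < n) c i *: g i.

Record linearCategory (k : fieldType) := LinearCategory {
  obj :> Type;
  hom : obj -> obj -> lmodType k;
  idm : forall X, hom X X;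
  comp : forall X Y Z, hom Y Z -> hom X Y -> hom X Z;
  comp1m : forall X Y (f : hom X Y), comp (idm Y) f = f;
  compm1 : forall X Y (f : hom X Y), comp f (idm X) = f;
  compA : forall W X Y Z (h : hom Y Z) (g : hom X Y) (f : hom W X),
    comp h (comp g f) = comp (comp h g) f;
  comp_linearr : forall X Y Z (g : hom Y Z),
    linear (comp g : hom X Y -> hom X Z);
  comp_linearl : forall X Y Z (f : hom X Y),
    linear (fun g : hom Y Z => comp g f)
}.

Arguments hom {k C} X Y : rename.
Arguments idm {k C} X : rename.
Notation "g \c f" := (comp g f) : cat_scope.

Section LinearCategoryNotions.
Variables (k : fieldType) (C : linearCategory k).
Implicit Types X Y Z : C.

Definition is_inverse X Y (f : hom X Y) (g : hom Y X) : Prop :=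
  g \c f = idm X /\ f \c g = idm Y.

Definition is_iso X Y (f : hom X Y) : Prop := exists g, is_inverse f g.

Definition is_mono X Y (f : hom X Y) : Prop :=
  forall Z (g h : hom Z X), f \c g = f \c h -> g = h.

Definition is_epi X Y (f : hom X Y) : Prop :=
  forall Z (g h : hom Y Z), g \c f = h \c f -> g = h.

Definition is_zero_object Z : Prop :=
  (forall X (f g : hom X Z), f = g) /\ (forall X (f g : hom Z X), f = g).

Definition is_biproduct X Y P (i1 : hom X P) (i2 : hom Y P)
    (p1 : hom P X) (p2 : hom P Y) : Prop :=
  [/\ p1 \c i1 = idm X, p2 \c i2 = idm Y, p1 \c i2 = 0, p2 \c i1 = 0
    & i1 \c p1 + i2 \c p2 = idm P].

Definition is_kernel X Y K (f : hom X Y) (i : hom K X) : Prop :=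
  f \c i = 0 /\
  forall Z (g : hom Z X), f \c g = 0 -> exists! h : hom Z K, i \c h = g.

Definition is_cokernel X Y Q (f : hom X Y) (p : hom Y Q) : Prop :=
  p \c f = 0 /\
  forall Z (g : hom Y Z), g \c f = 0 -> exists! h : hom Q Z, h \c p = g.

Definition is_abelian : Prop :=
  [/\ exists Z, is_zero_object Z,
      forall X Y, exists P (i1 : hom X P) (i2 : hom Y P)
        (p1 : hom P X) (p2 : hom P Y), is_biproduct i1 i2 p1 p2,
      forall X Y (f : hom X Y),
        (exists K (i : hom K X), is_kernel f i) /\
        (exists Q (p : hom Y Q), is_cokernel f p),
      forall X Y (f : hom X Y), is_mono f ->
        exists Z (g : hom Y Z), is_kernel g f
    & forall X Y (f : hom X Y), is_epi f ->
        exists Z (g : hom Z X), is_cokernel g f].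

Definition is_simple X : Prop :=
  ~ is_zero_object X /\
  forall Y (i : hom Y X), is_mono i -> is_zero_object Y \/ is_iso i.

(* A composition series of X, built from the bottom up. *)
Inductive finite_length : C -> Prop :=
| finite_length_zero X : is_zero_object X -> finite_length X
| finite_length_step X Y S (i : hom X Y) (p : hom Y S) :
    finite_length X -> is_mono i -> is_cokernel i p -> is_simple S ->
    finite_length Y.

End LinearCategoryNotions.

Record linearFunctor (k : fieldType) (C D : linearCategory k) := LinearFunctor {
  fobj :> C -> D;
  fmap : forall X Y, hom X Y -> hom (fobj X) (fobj Y);
  fmap1 : forall X, fmap (idm X) = idm (fobj X);
  fmapM : forall X Y Z (g : hom Y Z) (f : hom X Y),
    fmap (g \c f) = fmap g \c fmap f;
  fmap_linear : forall X Y, linear (@fmap X Y)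
}.

Section Functors.
Variable k : fieldType.

Definition id_functor (C : linearCategory k) : linearFunctor C C.
Proof. by refine (@LinearFunctor k C C id (fun X Y f => f) _ _ _). Defined.

Definition comp_functor (C D E : linearCategory k)
  (G : linearFunctor D E) (F : linearFunctor C D) : linearFunctor C E.
Proof.
refine (@LinearFunctor k C E (fun X => G (F X)) (fun X Y f => fmap G (fmap F f))
  _ _ _).
- by move=> X; rewrite !fmap1.
- by move=> X Y Z g f; rewrite !fmapM.
- by move=> X Y a f g; rewrite !fmap_linear.
Defined.

Definition is_natural (C D : linearCategory k) (F G : linearFunctor C D)
    (eta : forall X, hom (F X) (G X)) : Prop :=
  forall X Y (f : hom X Y), eta Y \c fmap F f = fmap G f \c eta X.

Definition is_natural_iso (C D : linearCategory k) (F G : linearFunctor C D)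
    (eta : forall X, hom (F X) (G X)) : Prop :=
  is_natural eta /\ forall X, is_iso (eta X).

Definition linearly_equivalent (C D : linearCategory k) : Prop :=
  exists (F : linearFunctor C D) (G : linearFunctor D C)
    (eta : forall X, hom (id_functor C X) (comp_functor G F X))
    (eps : forall Y, hom (comp_functor F G Y) (id_functor D Y)),
    is_natural_iso eta /\ is_natural_iso eps.

End Functors.

Section ModHom.
Variables (k : fieldType) (A : falgType k) (M N : lmodType A).

Definition modHom := {linear M -> N}.

Lemma modHomP (f g : modHom) : (f : M -> N) =1 g -> f = g.
Proof.
case: f g => [f [[a] [b]]] [g [[c] [d]]] /= /funext fg.
case: g / fg c d => c d; congr GRing.Linear.Pack; congr GRing.Linear.Class.
- by congr GRing.isNmodMorphism.Axioms_; exact: Prop_irrelevance.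
- by congr GRing.isScalable.Axioms_; exact: Prop_irrelevance.
Qed.

HB.instance Definition _ := gen_eqMixin modHom.
HB.instance Definition _ := gen_choiceMixin modHom.

Definition modHom0 : modHom := \0.
Definition modHomN (f : modHom) : modHom := \- f.
Definition modHomD (f g : modHom) : modHom := f \+ g.

Definition modHomZ_fun (c : k) (f : modHom) (x : M) : N := (c%:A : A) *: f x.

Lemma modHomZ_linear (c : k) (f : modHom) : linear (modHomZ_fun c f).
Proof.
move=> a x y; rewrite /modHomZ_fun linearP scalerDr !scalerA.
by rewrite mulr_algl mulr_algr.
Qed.

HB.instance Definition _ c f :=
  GRing.isLinear.Build A M N *:%R (modHomZ_fun c f) (modHomZ_linear c f).

Definition modHomZ (c : k) (f : modHom) : modHom := modHomZ_fun c f.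

Lemma modHomDA : associative modHomD.
Proof. by move=> f g h; apply: modHomP => x /=; rewrite addrA. Qed.
Lemma modHomDC : commutative modHomD.
Proof. by move=> f g; apply: modHomP => x /=; rewrite addrC. Qed.
Lemma modHom0D : left_id modHom0 modHomD.
Proof. by move=> f; apply: modHomP => x /=; rewrite add0r. Qed.
Lemma modHomND : left_inverse modHom0 modHomN modHomD.
Proof. by move=> f; apply: modHomP => x /=; rewrite addNr. Qed.

HB.instance Definition _ :=
  GRing.isZmodule.Build modHom modHomDA modHomDC modHom0D modHomND.

Lemma modHomZA a b (f : modHom) : modHomZ a (modHomZ b f) = modHomZ (a * b) f.
Proof.
by apply: modHomP => x; rewrite /= /modHomZ_fun scalerA mulr_algl scalerA.
Qed.
Lemma modHom1Z : left_id 1 modHomZ.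
Proof. by move=> f; apply: modHomP => x; rewrite /= /modHomZ_fun !scale1r. Qed.
Lemma modHomZDr : right_distributive modHomZ +%R.
Proof.
by move=> a f g; apply: modHomP => x; rewrite /= /modHomZ_fun scalerDr.
Qed.
Lemma modHomZDl (f : modHom) : {morph modHomZ^~ f : a b / a + b}.
Proof.
by move=> a b; apply: modHomP => x; rewrite /= /modHomZ_fun !scalerDl.
Qed.

HB.instance Definition _ := GRing.Zmodule_isLmodule.Build k modHom
  modHomZA modHom1Z modHomZDr modHomZDl.

End ModHom.

Section ModuleCategory.
Variables (k : fieldType) (A : falgType k).

Record fgModule := FgModule {
  fg_mod :> lmodType A;
  fg_modP : fin_generated fg_mod
}.

Definition mod1 (M : lmodType A) : modHom M M := idfun.
Definition modM (M N P : lmodType A) (g : modHom N P) (f : modHom M N) :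
  modHom M P := g \o f.

Definition fgModule_category : linearCategory k.
Proof.
refine (@LinearCategory k fgModule (fun M N => modHom M N : lmodType k)
  (fun M => mod1 M) (fun M N P => @modM M N P) _ _ _ _ _).
- by move=> M N f; apply: modHomP.
- by move=> M N f; apply: modHomP.
- by move=> M N P Q h g f; apply: modHomP.
- move=> M N P g a f f'; apply: modHomP => x.
  by rewrite /= raddfD /= /modHomZ_fun linearZ.
- by move=> M N P f a g g'; apply: modHomP.
Defined.

End ModuleCategory.

(* [falgType] algebras are nonzero; this only excludes the zero category. *)
Definition is_finite_category (k : fieldType) (C : linearCategory k) : Prop :=
  exists A : falgType k, linearly_equivalent C (fgModule_category A).

Record monoidalCategory (k : fieldType) := MonoidalCategory {
  mc_cat :> linearCategory k;
  tens : mc_cat -> mc_cat -> mc_cat;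
  tensm : forall X X' Y Y' : mc_cat, hom X X' -> hom Y Y' ->
    hom (tens X Y) (tens X' Y');
  unit_obj : mc_cat;
  assoc : forall X Y Z, hom (tens (tens X Y) Z) (tens X (tens Y Z));
  associ : forall X Y Z, hom (tens X (tens Y Z)) (tens (tens X Y) Z);
  lunit : forall X, hom (tens unit_obj X) X;
  luniti : forall X, hom X (tens unit_obj X);
  runit : forall X, hom (tens X unit_obj) X;
  runiti : forall X, hom X (tens X unit_obj);
  tensm_linearl : forall X X' Y Y' (g : hom Y Y'),
    linear (fun f : hom X X' => tensm f g);
  tensm_linearr : forall X X' Y Y' (f : hom X X'),
    linear (fun g : hom Y Y' => tensm f g);
  tensm1 : forall X Y, tensm (idm X) (idm Y) = idm (tens X Y);
  tensmM : forall X X' X'' Y Y' Y'' (f' : hom X' X'') (f : hom X X')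
      (g' : hom Y' Y'') (g : hom Y Y'),
    tensm (f' \c f) (g' \c g) = tensm f' g' \c tensm f g;
  assocK : forall X Y Z, is_inverse (assoc X Y Z) (associ X Y Z);
  lunitK : forall X, is_inverse (lunit X) (luniti X);
  runitK : forall X, is_inverse (runit X) (runiti X);
  assoc_natural : forall X X' Y Y' Z Z'
      (f : hom X X') (g : hom Y Y') (h : hom Z Z'),
    assoc X' Y' Z' \c tensm (tensm f g) h =
    tensm f (tensm g h) \c assoc X Y Z;
  lunit_natural : forall X X' (f : hom X X'),
    lunit X' \c tensm (idm unit_obj) f = f \c lunit X;
  runit_natural : forall X X' (f : hom X X'),
    runit X' \c tensm f (idm unit_obj) = f \c runit X;
  pentagon : forall W X Y Z,
    assoc W X (tens Y Z) \c assoc (tens W X) Y Z =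
    tensm (idm W) (assoc X Y Z) \c assoc W (tens X Y) Z
      \c tensm (assoc W X Y) (idm Z);
  triangle : forall X Y,
    tensm (idm X) (lunit Y) \c assoc X unit_obj Y =
    tensm (runit X) (idm Y)
}.

Arguments unit_obj {k C} : rename.
Notation "X ⊗ Y" := (tens X Y) : cat_scope.
Notation "f ⊗m g" := (tensm f g) : cat_scope.
Notation "'𝟙'" := unit_obj : cat_scope.

Section CompLemmas.
Variables (k : fieldType) (C : linearCategory k).

Lemma precomp W X Y Y' Z (f : hom X Y) (g : hom Y Z) (f' : hom X Y')
    (g' : hom Y' Z) :
  g \c f = g' \c f' :> hom X Z ->
  forall h : hom (W : C) X, g \c (f \c h) = g' \c (f' \c h).
Proof. by move=> e h; rewrite !compA e. Qed.

Lemma precomp1 W X Y (f : hom X Y) (g : hom Y X) :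
  g \c f = idm X -> forall h : hom (W : C) X, g \c (f \c h) = h.
Proof. by move=> e h; rewrite compA e comp1m. Qed.

Lemma iso_epi X Y Z (f : hom X Y) (f' : hom (Y : C) X) (g h : hom Y Z) :
  is_inverse f f' -> g \c f = h \c f -> g = h.
Proof.
by case=> _ e /(congr1 (fun u => u \c f')); rewrite -!compA e !compm1.
Qed.

Lemma iso_mono X Y Z (f : hom X Y) (f' : hom (Y : C) X) (g h : hom Z X) :
  is_inverse f f' -> f \c g = f \c h -> g = h.
Proof.
by case=> e _ /(congr1 (fun u => f' \c u)); rewrite !compA e !comp1m.
Qed.

Lemma inverse_sym X Y (f : hom (X : C) Y) g :
  is_inverse f g -> is_inverse g f.
Proof. by case. Qed.

Lemma inverse_comp X Y Z (f : hom (X : C) Y) f'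
    (g : hom Y Z) g' :
  is_inverse f f' -> is_inverse g g' -> is_inverse (g \c f) (f' \c g').
Proof.
case=> a b [c d]; split.
  by rewrite -compA (compA g') c comp1m.
by rewrite -compA (compA f) b comp1m.
Qed.

Lemma inverse_square X Y X' Y' (f : hom (X : C) Y) f'
    (g : hom X' Y') g' (a : hom X X') (b : hom Y Y') :
  is_inverse f f' -> is_inverse g g' -> g \c a = b \c f -> a \c f' = g' \c b.
Proof.
move=> hf hg e; apply: (iso_mono hg); rewrite !compA e -compA (proj2 hf) compm1.
by rewrite (proj2 hg) comp1m.
Qed.

End CompLemmas.

Section Coherence.
Variables (k : fieldType) (C : monoidalCategory k).
Implicit Types W X Y Z : C.

Lemma tensm_compl X X' X'' Y (f' : hom X' X'') (f : hom X X') :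
  (f' \c f) ⊗m idm Y = (f' ⊗m idm Y) \c (f ⊗m idm Y).
Proof. by rewrite -tensmM comp1m. Qed.

Lemma tensm_compr X Y Y' Y'' (g' : hom Y' Y'') (g : hom Y Y') :
  idm X ⊗m (g' \c g) = (idm X ⊗m g') \c (idm X ⊗m g).
Proof. by rewrite -tensmM comp1m. Qed.

Lemma tensm_comprA W X Y Y' Y'' (g' : hom Y' Y'') (g : hom Y Y')
    (h : hom W (X ⊗ Y)) :
  (idm X ⊗m g') \c ((idm X ⊗m g) \c h) = (idm X ⊗m (g' \c g)) \c h.
Proof. by rewrite compA -tensm_compr. Qed.

Lemma tensm_exchange X X' Y Y' (f : hom X X') (g : hom Y Y') :
  (f ⊗m idm Y') \c (idm X ⊗m g) = (idm X' ⊗m g) \c (f ⊗m idm Y).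
Proof. by rewrite -!tensmM !comp1m !compm1. Qed.

Lemma tensm_inverse X X' Y Y' (f : hom X X') f' (g : hom Y Y') g' :
  is_inverse f f' -> is_inverse g g' -> is_inverse (f ⊗m g) (f' ⊗m g').
Proof.
by move=> [a b] [c d]; split; rewrite -tensmM ?a ?b ?c ?d tensm1.
Qed.

Lemma idm_inverse X : is_inverse (idm X) (idm X).
Proof. by split; rewrite comp1m. Qed.

Lemma tens1m_inj X Y (f g : hom X Y) :
  idm 𝟙 ⊗m f = idm 𝟙 ⊗m g -> f = g.
Proof.
move=> /(congr1 (fun u => lunit Y \c u)); rewrite !lunit_natural.
exact: iso_epi (lunitK X).
Qed.

Lemma tensm1_inj X Y (f g : hom X Y) :
  f ⊗m idm 𝟙 = g ⊗m idm 𝟙 -> f = g.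
Proof.
move=> /(congr1 (fun u => runit Y \c u)); rewrite !runit_natural.
exact: iso_epi (runitK X).
Qed.

Lemma pentagonr W X Y Z :
  (idm W ⊗m assoc X Y Z) \c (assoc W (X ⊗ Y) Z \c (assoc W X Y ⊗m idm Z)) =
  assoc W X (Y ⊗ Z) \c assoc (W ⊗ X) Y Z.
Proof. by rewrite pentagon compA. Qed.

Lemma pentagonrc V W X Y Z (h : hom V (((W ⊗ X) ⊗ Y) ⊗ Z)) :
  (idm W ⊗m assoc X Y Z) \c
    (assoc W (X ⊗ Y) Z \c ((assoc W X Y ⊗m idm Z) \c h)) =
  assoc W X (Y ⊗ Z) \c (assoc (W ⊗ X) Y Z \c h).
Proof. by rewrite !compA pentagon. Qed.

Lemma lunit_tens X Y : lunit (X ⊗ Y) \c assoc 𝟙 X Y = lunit X ⊗m idm Y.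
Proof.
apply: tens1m_inj; rewrite tensm_compr.
apply: (iso_epi (assocK 𝟙 (𝟙 ⊗ X) Y)).
apply: (iso_epi (tensm_inverse (assocK 𝟙 𝟙 X) (idm_inverse Y))).
rewrite -!compA pentagonr compA triangle.
rewrite -tensm1 -assoc_natural -triangle tensm_compl.
by rewrite compA assoc_natural compA.
Qed.

Lemma runit_tens X Y : (idm X ⊗m runit Y) \c assoc X Y 𝟙 = runit (X ⊗ Y).
Proof.
apply: tensm1_inj; apply: (iso_mono (assocK X Y 𝟙)).
rewrite tensm_compl compA assoc_natural -triangle tensm_compr.
rewrite -!compA pentagonr [LHS]compA -assoc_natural.
by rewrite -compA tensm1 triangle.
Qed.

Lemma lunit_runit : lunit 𝟙 = runit 𝟙 :> hom _ (𝟙 : C).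
Proof.
apply: tensm1_inj; rewrite -lunit_tens -triangle.
by congr (_ \c _); apply: (iso_mono (lunitK 𝟙)); rewrite lunit_natural.
Qed.
End Coherence.

Section Duality.
Variables (k : fieldType) (C : monoidalCategory k).
Implicit Types (D V W X Y : C).

(* D is a left dual of V; equivalently, V is a right dual of D. *)
Definition is_duality D V (ev : hom (D ⊗ V) 𝟙) (coev : hom 𝟙 (V ⊗ D)) : Prop :=
  runit V \c (idm V ⊗m ev) \c assoc V D V \c (coev ⊗m idm V) \c luniti V
    = idm V /\
  lunit D \c (ev ⊗m idm D) \c associ D V D \c (idm D ⊗m coev) \c runiti D
    = idm D.

Definition contract D V (e : hom (D ⊗ V) 𝟙) X : hom (D ⊗ (V ⊗ X)) X :=
  lunit X \c (e ⊗m idm X) \c associ D V X.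

Definition insert D V (c : hom 𝟙 (V ⊗ D)) X : hom X (V ⊗ (D ⊗ X)) :=
  assoc V D X \c (c ⊗m idm X) \c luniti X.

(* For D dual to V with copairing [c], the unique morphism X -> D whose pairing
   with V is [u]; see [ev_mate] and [ev_inj]. *)
Definition mate V X D (u : hom (X ⊗ V) 𝟙) (c : hom 𝟙 (V ⊗ D)) : hom X D :=
  contract u D \c (idm X ⊗m c) \c runiti X.

(* W^* ⊗ V^* as a left dual of V ⊗ W. *)
Definition ev_tens DV V DW W (e : hom (DV ⊗ V) 𝟙) (e' : hom (DW ⊗ W) 𝟙) :
    hom ((DW ⊗ DV) ⊗ (V ⊗ W)) 𝟙 :=
  e' \c (idm DW ⊗m contract e W) \c assoc DW DV (V ⊗ W).

Definition coev_tens DV V DW W (c : hom 𝟙 (V ⊗ DV)) (c' : hom 𝟙 (W ⊗ DW)) :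
    hom 𝟙 ((V ⊗ W) ⊗ (DW ⊗ DV)) :=
  associ V W (DW ⊗ DV) \c (idm V ⊗m insert c' DV) \c c.

Lemma associ_natural X X' Y Y' Z Z' (f : hom X X') (g : hom Y Y')
    (h : hom Z Z') :
  ((f ⊗m g) ⊗m h) \c associ X Y Z = associ X' Y' Z' \c (f ⊗m (g ⊗m h)).
Proof.
apply: inverse_square (assocK _ _ _) (assocK _ _ _) _; exact: assoc_natural.
Qed.

Lemma luniti_natural X X' (f : hom X X') :
  (idm 𝟙 ⊗m f) \c luniti X = luniti X' \c f.
Proof.
apply: inverse_square (lunitK _) (lunitK _) _; exact: lunit_natural.
Qed.

Lemma runiti_natural X X' (f : hom X X') :
  (f ⊗m idm 𝟙) \c runiti X = runiti X' \c f.
Proof.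
apply: inverse_square (runitK _) (runitK _) _; exact: runit_natural.
Qed.

Lemma luniti_tens X Y :
  assoc 𝟙 X Y \c (luniti X ⊗m idm Y) = luniti (X ⊗ Y).
Proof.
apply: (iso_mono (lunitK (X ⊗ Y))); rewrite compA lunit_tens -tensm_compl.
by rewrite (proj2 (lunitK _)) (proj2 (lunitK _)) tensm1.
Qed.

Lemma runiti_tens X Y :
  assoc X Y 𝟙 \c runiti (X ⊗ Y) = idm X ⊗m runiti Y.
Proof.
apply: (iso_mono (tensm_inverse (idm_inverse X) (runitK Y))).
rewrite compA runit_tens -tensm_compr (proj2 (runitK _)) (proj2 (runitK _)).
by rewrite tensm1.
Qed.

Lemma luniti_runiti : luniti 𝟙 = runiti 𝟙 :> hom (𝟙 : C) _.
Proof.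
apply: (iso_mono (lunitK 𝟙)); rewrite (proj2 (lunitK _)) lunit_runit.
by rewrite (proj2 (runitK _)).
Qed.

Lemma contract_natural D V (e : hom (D ⊗ V) 𝟙) X X' (f : hom X X') :
  contract e X' \c (idm D ⊗m (idm V ⊗m f)) = f \c contract e X.
Proof.
rewrite /contract -!compA -associ_natural tensm1 (precomp (tensm_exchange e f)).
by rewrite (precomp (lunit_natural f)).
Qed.

Lemma insert_natural D V (c : hom 𝟙 (V ⊗ D)) X X' (f : hom X X') :
  (idm V ⊗m (idm D ⊗m f)) \c insert c X = insert c X' \c f.
Proof.
rewrite /insert !compA -assoc_natural tensm1 -!compA -luniti_natural.
by rewrite (precomp (esym (tensm_exchange c f))).
Qed.

Lemma contract_precomp D D' V (e : hom (D ⊗ V) 𝟙) (f : hom D' D) X :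
  contract (e \c (f ⊗m idm V)) X = contract e X \c (f ⊗m idm (V ⊗ X)).
Proof. by rewrite /contract tensm_compl -!compA -tensm1 associ_natural. Qed.

Lemma contract_postcomp D V V' (e : hom (D ⊗ V') 𝟙) (f : hom V V') X :
  contract (e \c (idm D ⊗m f)) X =
  contract e X \c (idm D ⊗m (f ⊗m idm X)).
Proof. by rewrite /contract tensm_compl -!compA associ_natural. Qed.

Lemma contract_tensr D V (e : hom (D ⊗ V) 𝟙) X Y :
  contract e X ⊗m idm Y =
  contract e (X ⊗ Y) \c (idm D ⊗m assoc V X Y) \c assoc D (V ⊗ X) Y.
Proof.
apply: (iso_epi (tensm_inverse (assocK D V X) (idm_inverse Y))).
rewrite /contract -!compA pentagonr.
rewrite (precomp1 (proj1 (assocK D V (X ⊗ Y)))).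
rewrite -tensm_compl -!compA (proj1 (assocK D V X)) compm1.
by rewrite tensm_compl -lunit_tens -compA assoc_natural tensm1.
Qed.

Lemma insert_tensr D V (c : hom 𝟙 (V ⊗ D)) X Y :
  (idm V ⊗m assoc D X Y) \c assoc V (D ⊗ X) Y \c (insert c X ⊗m idm Y) =
  insert c (X ⊗ Y).
Proof.
rewrite /insert !tensm_compl -!compA pentagonrc.
by rewrite (precomp (assoc_natural _ _ _)) luniti_tens tensm1.
Qed.

Lemma contract_unit D V (e : hom (D ⊗ V) 𝟙) :
  contract e 𝟙 = e \c (idm D ⊗m runit V).
Proof.
rewrite /contract lunit_runit runit_natural -compA; congr (_ \c _).
by rewrite -runit_tens -compA (proj2 (assocK _ _ _)) compm1.
Qed.

Lemma insert_unit D V (c : hom 𝟙 (V ⊗ D)) :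
  insert c 𝟙 = (idm V ⊗m runiti D) \c c.
Proof.
rewrite /insert luniti_runiti -compA runiti_natural compA.
by rewrite runiti_tens.
Qed.

Lemma contract_tens DV V DW W (e : hom (DV ⊗ V) 𝟙) (e' : hom (DW ⊗ W) 𝟙) X :
  contract (ev_tens e e') X =
  contract e' X \c (idm DW ⊗m contract e (W ⊗ X))
    \c assoc DW DV (V ⊗ (W ⊗ X)) \c (idm (DW ⊗ DV) ⊗m assoc V W X).
Proof.
apply: (iso_epi (assocK (DW ⊗ DV) (V ⊗ W) X)).
rewrite [contract (ev_tens e e') X]/contract [contract e' X]/contract.
rewrite /ev_tens -[LHS]compA.
rewrite (proj1 (assocK _ _ _)) compm1.
rewrite !tensm_compl -!compA; congr (_ \c (_ \c _)).
apply: (iso_mono (assocK DW W X)).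
rewrite (precomp1 (proj2 (assocK DW W X))).
rewrite (precomp (assoc_natural _ _ _)) contract_tensr !tensm_compr -!compA.
rewrite pentagonr; congr (_ \c _).
by rewrite -(tensm1 DW DV) (precomp (assoc_natural _ _ _)).
Qed.

Lemma insert_tens DV V DW W (c : hom 𝟙 (V ⊗ DV)) (c' : hom 𝟙 (W ⊗ DW)) X :
  assoc V W ((DW ⊗ DV) ⊗ X) \c insert (coev_tens c c') X =
  (idm V ⊗m ((idm W ⊗m associ DW DV X) \c insert c' (DV ⊗ X)))
    \c insert c X.
Proof.
have E : (idm W ⊗m associ DW DV X) \c insert c' (DV ⊗ X) =
    assoc W (DW ⊗ DV) X \c (insert c' DV ⊗m idm X).
  rewrite -insert_tensr -!compA compA -tensm_compr (proj1 (assocK _ _ _)).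
  by rewrite tensm1 comp1m.
rewrite [insert (coev_tens c c') X]/insert [insert c X]/insert.
rewrite /coev_tens !tensm_compl -!compA.
rewrite -pentagonrc E [in RHS]tensm_compr -!compA; congr (_ \c _).
rewrite -(precomp (assoc_natural _ _ _)); congr (_ \c _).
by rewrite (precomp1 (proj2 (tensm_inverse (assocK _ _ _) (idm_inverse X)))).
Qed.

Definition zigzag1 D V (e : hom (D ⊗ V) 𝟙) (c : hom 𝟙 (V ⊗ D)) : Prop :=
  forall X, (idm V ⊗m contract e X) \c insert c (V ⊗ X) = idm (V ⊗ X).

Definition zigzag2 D V (e : hom (D ⊗ V) 𝟙) (c : hom 𝟙 (V ⊗ D)) : Prop :=
  forall X, contract e (D ⊗ X) \c (idm D ⊗m insert c X) = idm (D ⊗ X).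

Lemma duality_zigzag D V (e : hom (D ⊗ V) 𝟙) (c : hom 𝟙 (V ⊗ D)) :
  is_duality e c -> zigzag1 e c /\ zigzag2 e c.
Proof.
case=> z1 z2; split=> X.
- have := congr1 (fun f => f ⊗m idm X) z1.
  rewrite tensm1 !tensm_compl -triangle => <-.
  rewrite /contract /insert !tensm_compr -!compA; congr (_ \c _).
  rewrite (precomp (assoc_natural _ _ _)); congr (_ \c _).
  rewrite -luniti_tens; apply: (iso_mono
    (tensm_inverse (idm_inverse V) (assocK D V X))).
  rewrite pentagonrc (precomp1 (proj2 (tensm_inverse (idm_inverse V)
    (assocK D V X)))).
  by rewrite (precomp (assoc_natural c _ _)) tensm1.
- have := congr1 (fun f => f ⊗m idm X) z2.
  rewrite tensm1 !tensm_compl -lunit_tens => <-.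
  rewrite /contract /insert !tensm_compr -!compA; congr (_ \c _).
  rewrite (precomp (assoc_natural e _ _)) tensm1; congr (_ \c _).
  apply: (iso_mono (assocK D V (D ⊗ X))).
  rewrite (precomp1 (proj2 (assocK D V (D ⊗ X)))).
  rewrite -pentagonrc (precomp1 (proj2 (tensm_inverse (assocK D V D)
    (idm_inverse X)))).
  rewrite (precomp (assoc_natural _ c _)).
  have -> : idm D ⊗m luniti X = assoc D 𝟙 X \c (runiti D ⊗m idm X).
    apply: (iso_mono (tensm_inverse (idm_inverse D) (lunitK X))).
    rewrite -tensm_compr (proj2 (lunitK X)) compA triangle -tensm_compl.
    by rewrite (proj2 (runitK D)) !tensm1.
  by rewrite !compA.
Qed.

Lemma zigzag_duality D V (e : hom (D ⊗ V) 𝟙) (c : hom 𝟙 (V ⊗ D)) :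
  zigzag1 e c -> zigzag2 e c -> is_duality e c.
Proof.
move=> /(_ 𝟙) z1 /(_ 𝟙) z2; split.
- apply: (iso_epi (runitK V)); rewrite comp1m -[RHS]compm1 -[in RHS]z1.
  rewrite contract_unit tensm_compr /insert -!compA; congr (_ \c (_ \c _)).
  rewrite -luniti_natural (precomp (tensm_exchange c _)) -(tensm1 V D).
  by rewrite (precomp (assoc_natural _ _ _)).
- move: z2; rewrite insert_unit tensm_compr compA contract_natural => z2.
  apply: (iso_mono (inverse_sym (runitK D))); rewrite compm1 -[RHS]comp1m -z2.
  by rewrite /contract !compA.
Qed.

Lemma duality_tens DV V DW W (e : hom (DV ⊗ V) 𝟙) (c : hom 𝟙 (V ⊗ DV))
    (e' : hom (DW ⊗ W) 𝟙) (c' : hom 𝟙 (W ⊗ DW)) :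
  is_duality e c -> is_duality e' c' ->
  is_duality (ev_tens e e') (coev_tens c c').
Proof.
move=> /duality_zigzag [z1 z2] /duality_zigzag [z1' z2'].
apply: zigzag_duality => X.
- apply: (iso_mono (assocK V W X)); rewrite compm1 compA -tensm1 assoc_natural.
  rewrite -compA insert_tens compA -tensm_compr.
  set Y := (V ⊗ W) ⊗ X.
  have -> : (idm W ⊗m contract (ev_tens e e') X)
        \c ((idm W ⊗m associ DW DV Y) \c insert c' (DV ⊗ Y)) =
      contract e (W ⊗ X) \c (idm DV ⊗m assoc V W X).
    rewrite contract_tens compA -tensm_compr -3!compA -(tensm1 DW DV).
    rewrite (precomp (assoc_natural (idm DW) (idm DV) (assoc V W X))).
    rewrite (proj2 (assocK _ _ _)) compm1 -tensm_compr.
    rewrite [X in X \c _]tensm_compr -compA.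
    by rewrite insert_natural compA z1' comp1m.
  by rewrite tensm_compr -compA insert_natural compA z1 comp1m.
- rewrite contract_tens -3!compA -tensm_compr insert_tens.
  rewrite -(tensm1 DW DV) assoc_natural tensm_comprA.
  have E Z (m : hom (DV ⊗ X) Z) :
      contract e Z \c (idm DV ⊗m ((idm V ⊗m m) \c insert c X)) = m.
    by rewrite tensm_compr compA contract_natural -compA z2 compm1.
  have E' Z (m : hom (DW ⊗ (DV ⊗ X)) Z) :
      contract e' Z \c (idm DW ⊗m ((idm W ⊗m m) \c insert c' (DV ⊗ X))) = m.
    by rewrite tensm_compr compA contract_natural -compA z2' compm1.
  by rewrite E compA E' (proj1 (assocK _ _ _)).
Qed.

Lemma duality_unit : is_duality (lunit 𝟙) (luniti (𝟙 : C)).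
Proof.
split.
- rewrite -!compA (compA (idm 𝟙 ⊗m lunit 𝟙)) triangle.
  have e := proj2 (tensm_inverse (runitK (𝟙 : C)) (idm_inverse 𝟙)).
  rewrite luniti_runiti (precomp1 e); exact: proj2 (runitK 𝟙).
- rewrite [in lunit 𝟙 ⊗m _]lunit_runit -triangle.
  rewrite -!compA (precomp1 (proj2 (assocK 𝟙 𝟙 𝟙))).
  rewrite (precomp1 (proj2 (tensm_inverse (idm_inverse 𝟙) (lunitK 𝟙)))).
  by rewrite lunit_runit (proj2 (runitK 𝟙)).
Qed.

Lemma mate_linear V X D (c : hom 𝟙 (V ⊗ D)) :
  linear (fun u : hom (X ⊗ V) 𝟙 => mate u c).
Proof.
move=> a u u'; rewrite /mate /contract tensm_linearl.
by rewrite comp_linearr !comp_linearl.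
Qed.

Lemma mate_comp V X X' D (u : hom (X ⊗ V) 𝟙) (c : hom 𝟙 (V ⊗ D))
    (h : hom X' X) : mate u c \c h = mate (u \c (h ⊗m idm V)) c.
Proof.
rewrite /mate contract_precomp -!compA; congr (_ \c (_ \c (_ \c _))).
by rewrite (precomp (tensm_exchange h c)) runiti_natural.
Qed.

Lemma ev_mate V D (e : hom (D ⊗ V) 𝟙) (c : hom 𝟙 (V ⊗ D)) X
    (u : hom (X ⊗ V) 𝟙) : is_duality e c -> e \c (mate u c ⊗m idm V) = u.
Proof.
move=> [z _]; rewrite /mate /contract !tensm_compl -!compA.
rewrite -lunit_tens -!compA.
rewrite (precomp (esym (lunit_natural e))).
rewrite (precomp (assoc_natural u _ _)) tensm1.
rewrite (precomp (esym (tensm_exchange u e))).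
rewrite lunit_runit (precomp (runit_natural u)).
rewrite -[RHS]compm1; congr (_ \c _).
apply: (iso_epi (tensm_inverse (runitK X) (idm_inverse V))).
rewrite -!compA -tensmM comp1m (proj1 (runitK X)) tensm1 compm1 comp1m.
rewrite -runit_tens -!compA.
rewrite -tensm1 (precomp (assoc_natural (idm X) (idm V) e)).
rewrite -pentagonrc.
rewrite (precomp1 (proj2 (tensm_inverse (assocK X V D) (idm_inverse V)))).
rewrite assoc_natural -triangle.
rewrite !tensm_comprA; congr (idm X ⊗m _ \c _).
apply: (iso_epi (inverse_sym (lunitK V))).
by rewrite (proj2 (lunitK V)) z.
Qed.

Lemma mate_dual V D (e : hom (D ⊗ V) 𝟙) (c : hom 𝟙 (V ⊗ D)) :
  is_duality e c -> mate e c = idm D.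
Proof. by case. Qed.

Lemma ev_inj V D (e : hom (D ⊗ V) 𝟙) (c : hom 𝟙 (V ⊗ D)) X (f g : hom X D) :
  is_duality e c -> e \c (f ⊗m idm V) = e \c (g ⊗m idm V) -> f = g.
Proof.
by move=> ec /(congr1 (@mate V X D ^~ c)); rewrite -!mate_comp mate_dual // !comp1m.
Qed.

Lemma mate_inverse V D (e : hom (D ⊗ V) 𝟙) c D' (e' : hom (D' ⊗ V) 𝟙) c' :
  is_duality e c -> is_duality e' c' -> is_inverse (mate e c') (mate e' c).
Proof.
move=> ec ec'; split.
- by apply: (ev_inj ec); rewrite tensm_compl compA !ev_mate // tensm1 compm1.
- by apply: (ev_inj ec'); rewrite tensm_compl compA !ev_mate // tensm1 compm1.
Qed.

End Duality.

Record rigidCategory (k : fieldType) := RigidCategory {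
  rc_cat :> monoidalCategory k;
  ldual : rc_cat -> rc_cat;
  ev : forall V, hom (ldual V ⊗ V) 𝟙;
  coev : forall V, hom 𝟙 (V ⊗ ldual V);
  ldualP : forall V, is_duality (ev V) (coev V);
  right_rigid : forall V : rc_cat, exists (D : rc_cat)
    (ev' : hom (V ⊗ D) 𝟙) (coev' : hom 𝟙 (D ⊗ V)), is_duality ev' coev'
}.

Record monoidalFunctor (k : fieldType) (C D : monoidalCategory k) :=
  MonoidalFunctor {
    mf_fun :> linearFunctor C D;
    mf2 : forall X Y, hom (mf_fun X ⊗ mf_fun Y) (mf_fun (X ⊗ Y));
    mf0 : hom 𝟙 (mf_fun 𝟙);
    mf2_iso : forall X Y, is_iso (mf2 X Y);
    mf0_iso : is_iso mf0;
    mf2_natural : forall X X' Y Y' (f : hom X X') (g : hom Y Y'),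
      mf2 X' Y' \c (fmap mf_fun f ⊗m fmap mf_fun g) =
      fmap mf_fun (f ⊗m g) \c mf2 X Y;
    mf_assoc : forall X Y Z,
      fmap mf_fun (assoc X Y Z) \c mf2 (X ⊗ Y) Z
        \c (mf2 X Y ⊗m idm (mf_fun Z)) =
      mf2 X (Y ⊗ Z) \c (idm (mf_fun X) ⊗m mf2 Y Z)
        \c assoc (mf_fun X) (mf_fun Y) (mf_fun Z);
    mf_lunit : forall X,
      fmap mf_fun (lunit X) \c mf2 𝟙 X \c (mf0 ⊗m idm (mf_fun X)) =
      lunit (mf_fun X);
    mf_runit : forall X,
      fmap mf_fun (runit X) \c mf2 X 𝟙 \c (idm (mf_fun X) ⊗m mf0) =
      runit (mf_fun X)
  }.

Definition id_monoidal (k : fieldType) (C : monoidalCategory k) :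
  monoidalFunctor C C.
Proof.
refine (@MonoidalFunctor k C C (id_functor C)
  (fun X Y => idm (X ⊗ Y)) (idm 𝟙) _ _ _ _ _ _).
- by move=> X Y; exists (idm _); exact: idm_inverse.
- by exists (idm _); exact: idm_inverse.
- by move=> X X' Y Y' f g; rewrite comp1m compm1.
- by move=> X Y Z; rewrite /= !tensm1 !compm1 !comp1m.
- by move=> X; rewrite /= !tensm1 !compm1.
- by move=> X; rewrite /= !tensm1 !compm1.
Defined.

Record Nat_tens (k : fieldType) (C D : monoidalCategory k)
    (F G : monoidalFunctor C D) := NatTens {
  nt_fun :> forall X, hom (F X) (G X);
  nt_natural : is_natural nt_fun;
  nt_tens : forall X Y,
    nt_fun (X ⊗ Y) \c mf2 F X Y = mf2 G X Y \c (nt_fun X ⊗m nt_fun Y);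
  nt_unit : nt_fun 𝟙 \c mf0 F = mf0 G
}.

(* [finite_set] of mathcomp.classical is not applicable to [Nat_tens] for
   universe reasons. *)
Definition is_finite_type (T : Type) : Prop :=
  exists (n : nat) (f : 'I_n -> T), bijective f.

Section DoubleDual.
Variables (k : fieldType) (C : rigidCategory k).
Implicit Types (V W X Y Z : C).

Definition dualm X Y (f : hom X Y) : hom (ldual Y) (ldual X) :=
  mate (ev Y \c (idm (ldual Y) ⊗m f)) (coev X).

(* The canonical isomorphism W^* ⊗ V^* ~ (V ⊗ W)^* and its inverse. *)
Definition dual_tens V W : hom (ldual W ⊗ ldual V) (ldual (V ⊗ W)) :=
  mate (ev_tens (ev V) (ev W)) (coev (V ⊗ W)).

Definition dual_tensi V W : hom (ldual (V ⊗ W)) (ldual W ⊗ ldual V) :=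
  mate (ev (V ⊗ W)) (coev_tens (coev V) (coev W)).

(* The canonical isomorphism 𝟙 ~ 𝟙^* and its inverse. *)
Definition dual_unit : hom 𝟙 (ldual (𝟙 : C)) := mate (lunit 𝟙) (coev 𝟙).

Definition dual_uniti : hom (ldual (𝟙 : C)) 𝟙 := mate (ev 𝟙) (luniti 𝟙).

Lemma ev_dualm X Y (f : hom X Y) :
  ev X \c (dualm f ⊗m idm X) = ev Y \c (idm (ldual Y) ⊗m f).
Proof. exact/ev_mate/ldualP. Qed.

Lemma ev_dual_tens V W :
  ev (V ⊗ W) \c (dual_tens V W ⊗m idm (V ⊗ W)) = ev_tens (ev V) (ev W).
Proof. exact/ev_mate/ldualP. Qed.

Lemma ev_dual_unit : ev 𝟙 \c (dual_unit ⊗m idm 𝟙) = lunit 𝟙.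
Proof. exact/ev_mate/ldualP. Qed.

Lemma dual_tensK V W : is_inverse (dual_tens V W) (dual_tensi V W).
Proof. apply: mate_inverse; [apply: duality_tens|]; exact: ldualP. Qed.

Lemma dual_unitK : is_inverse dual_unit dual_uniti.
Proof. apply: mate_inverse; [exact: duality_unit|exact: ldualP]. Qed.

Lemma dualm_linear X Y : linear (@dualm X Y).
Proof.
by move=> a f g; rewrite /dualm tensm_linearr comp_linearr mate_linear.
Qed.

Lemma dualm1 X : dualm (idm X) = idm (ldual X).
Proof. by rewrite /dualm tensm1 compm1; exact/mate_dual/ldualP. Qed.

Lemma dualmM X Y Z (g : hom Y Z) (f : hom X Y) :
  dualm (g \c f) = dualm f \c dualm g.
Proof.
rewrite [dualm f]/dualm mate_comp -compA -tensm_exchange compA ev_dualm.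
by rewrite /dualm tensm_compr compA.
Qed.

Lemma dualm_inverse X Y (f : hom X Y) g :
  is_inverse f g -> is_inverse (dualm f) (dualm g).
Proof. by case=> a b; split; rewrite -dualmM ?a ?b dualm1. Qed.

Lemma dual_tens_natural X X' Y Y' (f : hom X X') (g : hom Y Y') :
  dualm (f ⊗m g) \c dual_tens X' Y' =
  dual_tens X Y \c (dualm g ⊗m dualm f).
Proof.
apply: (ev_inj (ldualP _)); rewrite tensm_compl [in RHS]tensm_compl.
rewrite compA ev_dualm [RHS]compA ev_dual_tens -compA -tensm_exchange compA ev_dual_tens /ev_tens -2!compA.
rewrite -tensm1 assoc_natural tensm_comprA.
have -> : contract (ev X') Y' \c (idm (ldual X') ⊗m (f ⊗m g)) =
    g \c (contract (ev X) Y \c (dualm f ⊗m idm (X ⊗ Y))).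
  have -> : f ⊗m g = (idm X' ⊗m g) \c (f ⊗m idm Y).
    by rewrite -tensmM comp1m compm1.
  rewrite tensm_compr compA contract_natural -compA; congr (_ \c _).
  by rewrite -contract_postcomp -ev_dualm contract_precomp.
set h := contract _ _ \c (dualm f ⊗m _).
rewrite [in LHS]tensm_compr -(compA (idm _ ⊗m g)) [LHS]compA -ev_dualm -compA.
rewrite -[RHS]compA assoc_natural -[RHS]compA.
have e : (idm (ldual Y) ⊗m contract (ev X) Y)
      \c (dualm g ⊗m (dualm f ⊗m idm (X ⊗ Y))) =
    (dualm g ⊗m idm Y) \c (idm (ldual Y') ⊗m h).
  by rewrite -!tensmM !comp1m compm1.
by rewrite (precomp e).
Qed.

Lemma contract_dual_tens U V X :
  contract (ev (U ⊗ V)) X \c (dual_tens U V ⊗m idm ((U ⊗ V) ⊗ X)) =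
  contract (ev V) X \c (idm (ldual V) ⊗m contract (ev U) (V ⊗ X))
    \c assoc (ldual V) (ldual U) (U ⊗ (V ⊗ X))
    \c (idm (ldual V ⊗ ldual U) ⊗m assoc U V X).
Proof. by rewrite -contract_precomp ev_dual_tens contract_tens. Qed.

Lemma ev_tens_precomp U V X (f : hom X (ldual U)) :
  ev_tens (ev U) (ev V) \c ((idm (ldual V) ⊗m f) ⊗m idm (U ⊗ V)) =
  ev V \c ((idm (ldual V) ⊗m
    (contract (ev U) V \c (f ⊗m idm (U ⊗ V)))) \c assoc _ _ _).
Proof. by rewrite /ev_tens -2!compA assoc_natural tensm_comprA. Qed.

Lemma ev_tens_precompl V W X (f : hom X (ldual W)) :
  ev_tens (ev V) (ev W) \c ((f ⊗m idm (ldual V)) ⊗m idm (V ⊗ W)) =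
  ev W \c (f ⊗m idm W) \c (idm X ⊗m contract (ev V) W) \c assoc _ _ _.
Proof.
rewrite /ev_tens -2!compA assoc_natural tensm1 -[RHS]compA -[RHS]compA.
by rewrite (precomp (esym (tensm_exchange f _))).
Qed.

Lemma dual_tens_assoc U V W :
  dual_tens (U ⊗ V) W \c (idm (ldual W) ⊗m dual_tens U V)
    \c assoc (ldual W) (ldual V) (ldual U) =
  dualm (assoc U V W) \c dual_tens U (V ⊗ W)
    \c (dual_tens V W ⊗m idm (ldual U)).
Proof.
apply: (ev_inj (ldualP _)).
rewrite -[in LHS]compA tensm_compl [LHS]compA ev_dual_tens tensm_compl.
rewrite [LHS]compA ev_tens_precomp contract_dual_tens.
rewrite -[in RHS]compA [in RHS]tensm_compl [RHS]compA ev_dualm.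
rewrite [in RHS]tensm_compl -[RHS]compA.
rewrite -(precomp (tensm_exchange (dual_tens U (V ⊗ W)) _)).
rewrite -tensm_exchange [RHS]compA ev_dual_tens [RHS]compA ev_tens_precompl.
rewrite ev_dual_tens /ev_tens.
move: (contract (ev V) W) (contract (ev U) (V ⊗ W)) => p q.
rewrite !tensm_compr -!compA; congr (_ \c (_ \c _)).
rewrite -(tensm1 (ldual W) (ldual V)) (precomp (assoc_natural _ _ q)).
congr (_ \c _).
rewrite -(precomp (assoc_natural _ _ _)) tensm1 -tensm_exchange.
by rewrite pentagonrc.
Qed.

Lemma dual_tens_lunit X :
  dual_tens 𝟙 X \c (idm (ldual X) ⊗m dual_unit) =
  dualm (lunit X) \c runit (ldual X).
Proof.
apply: (ev_inj (ldualP _)); rewrite tensm_compl compA ev_dual_tens.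
rewrite ev_tens_precomp -contract_precomp ev_dual_unit.
rewrite [in RHS]tensm_compl [RHS]compA ev_dualm -[RHS]compA -tensm_exchange.
have -> : contract (lunit 𝟙) X = lunit X \c lunit (𝟙 ⊗ X) :> hom _ (X : C).
  rewrite /contract -lunit_tens -!compA (proj2 (assocK _ _ _)) compm1.
  by [].
rewrite tensm_compr -compA triangle.
by rewrite tensm_exchange.
Qed.

Lemma dual_tens_runit X :
  dual_tens X 𝟙 \c (dual_unit ⊗m idm (ldual X)) =
  dualm (runit X) \c lunit (ldual X).
Proof.
apply: (ev_inj (ldualP _)); rewrite tensm_compl compA ev_dual_tens.
rewrite ev_tens_precompl ev_dual_unit lunit_natural -compA lunit_tens.
by rewrite contract_unit [in RHS]tensm_compl [RHS]compA ev_dualm.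
Qed.

Definition double_dual_functor : linearFunctor C C.
Proof.
refine (@LinearFunctor k C C (fun X => ldual (ldual X))
  (fun X Y f => dualm (dualm f)) _ _ _).
- by move=> X; rewrite !dualm1.
- by move=> X Y Z g f; rewrite !dualmM.
- by move=> X Y a f g; rewrite !dualm_linear.
Defined.

(* X^** ⊗ Y^** ~ (Y^* ⊗ X^* )^* ~ (X ⊗ Y)^**. *)
Definition ddual_tens X Y :
    hom (ldual (ldual X) ⊗ ldual (ldual Y)) (ldual (ldual (X ⊗ Y))) :=
  dualm (dual_tensi X Y) \c dual_tens (ldual Y) (ldual X).

(* 𝟙 ~ 𝟙^* ~ 𝟙^**. *)
Definition ddual_unit : hom 𝟙 (ldual (ldual (𝟙 : C))) :=
  dualm dual_uniti \c dual_unit.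

Lemma dual_tensi_natural X X' Y Y' (f : hom X X') (g : hom Y Y') :
  (dualm g ⊗m dualm f) \c dual_tensi X' Y' =
  dual_tensi X Y \c dualm (f ⊗m g).
Proof.
apply: inverse_square (dual_tensK _ _) (dual_tensK _ _) _.
by rewrite dual_tens_natural.
Qed.

Lemma dual_tensi_assoc U V W :
  assoc (ldual W) (ldual V) (ldual U)
    \c (dual_tensi V W ⊗m idm (ldual U)) \c dual_tensi U (V ⊗ W) =
  (idm (ldual W) ⊗m dual_tensi U V) \c dual_tensi (U ⊗ V) W
    \c dualm (assoc U V W).
Proof.
have i1 := inverse_comp (tensm_inverse (dual_tensK V W) (idm_inverse (ldual U)))
  (dual_tensK U (V ⊗ W)).
have i2 := inverse_comp (tensm_inverse (idm_inverse (ldual W)) (dual_tensK U V))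
  (dual_tensK (U ⊗ V) W).
rewrite -compA; apply: inverse_square i1 i2 _.
by rewrite dual_tens_assoc compA.
Qed.

Lemma ddual_tens_natural X X' Y Y' (f : hom X X') (g : hom Y Y') :
  ddual_tens X' Y' \c (dualm (dualm f) ⊗m dualm (dualm g)) =
  dualm (dualm (f ⊗m g)) \c ddual_tens X Y.
Proof.
rewrite /ddual_tens -compA -dual_tens_natural compA [RHS]compA -!dualmM.
by rewrite dual_tensi_natural.
Qed.

Lemma ddual_tens_assoc X Y Z :
  dualm (dualm (assoc X Y Z)) \c ddual_tens (X ⊗ Y) Z
    \c (ddual_tens X Y ⊗m idm (ldual (ldual Z))) =
  ddual_tens X (Y ⊗ Z) \c (idm (ldual (ldual X)) ⊗m ddual_tens Y Z)
    \c assoc (ldual (ldual X)) (ldual (ldual Y)) (ldual (ldual Z)).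
Proof.
have L : dual_tens (ldual Z) (ldual (X ⊗ Y))
      \c (dualm (dual_tensi X Y) ⊗m idm (ldual (ldual Z))) =
    dualm (idm (ldual Z) ⊗m dual_tensi X Y)
      \c dual_tens (ldual Z) (ldual Y ⊗ ldual X).
  by rewrite dual_tens_natural dualm1.
have R : dual_tens (ldual (Y ⊗ Z)) (ldual X)
      \c (idm (ldual (ldual X)) ⊗m dualm (dual_tensi Y Z)) =
    dualm (dual_tensi Y Z ⊗m idm (ldual X))
      \c dual_tens (ldual Z ⊗ ldual Y) (ldual X).
  by rewrite dual_tens_natural dualm1.
have A := dual_tens_assoc (ldual Z) (ldual Y) (ldual X).
rewrite /ddual_tens tensm_compl tensm_compr.
move: L R A (dual_tensi_assoc X Y Z).
move: (dual_tensi X Y) (dual_tensi (X ⊗ Y) Z) (dual_tensi X (Y ⊗ Z))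
  (dual_tensi Y Z).
move: (dual_tens (ldual Y) (ldual X)) (dual_tens (ldual Z) (ldual (X ⊗ Y))).
move: (dual_tens (ldual (Y ⊗ Z)) (ldual X)) (dual_tens (ldual Z) (ldual Y)).
move: (dual_tens _ (ldual Y ⊗ ldual X)) (dual_tens (ldual Z ⊗ ldual Y) _).
move=> d1 d2 d3 d4 d5 d6 i1 i2 i3 i4 L R A I.
have {I} : dualm (dualm (assoc X Y Z)) \c (dualm i2 \c dualm (idm _ ⊗m i1)) =
    dualm i3 \c (dualm (i4 ⊗m idm _) \c dualm (assoc _ _ _)).
  by rewrite -!dualmM -I.
move: L R A; rewrite -compA.
move: (dualm (dualm _)) (dualm i1) (dualm i2) (dualm i3) (dualm i4).
move: (dualm (_ ⊗m i1)) (dualm (i4 ⊗m _)) (dualm (assoc _ _ _)).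
move=> e1 e2 e3 e4 e5 e6 e7 e8 L R A K; rewrite -!compA (precomp L) (precomp R).
by rewrite A !compA in K *; rewrite K.
Qed.

Lemma ddual_tens_lunit X :
  dualm (dualm (lunit X)) \c ddual_tens 𝟙 X
    \c (ddual_unit ⊗m idm (ldual (ldual X))) =
  lunit (ldual (ldual X)).
Proof.
have L : dual_tens (ldual X) (ldual 𝟙)
      \c (dualm dual_uniti ⊗m idm (ldual (ldual X))) =
    dualm (idm (ldual X) ⊗m dual_uniti) \c dual_tens (ldual X) 𝟙.
  by rewrite dual_tens_natural dualm1.
have i := inverse_comp (tensm_inverse (idm_inverse (ldual X)) dual_unitK)
  (dual_tensK 𝟙 X).
have I : (idm (ldual X) ⊗m dual_uniti) \c dual_tensi 𝟙 X \c dualm (lunit X) =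
    runiti (ldual X).
  rewrite -[RHS]comp1m; apply: esym.
  apply: inverse_square (runitK _) i _.
  by rewrite compm1 dual_tens_lunit.
have K : dualm (dualm (lunit X))
      \c (dualm (dual_tensi 𝟙 X) \c dualm (idm (ldual X) ⊗m dual_uniti)) =
    dualm (runiti (ldual X)) by rewrite -!dualmM I.
have [_ r] := dualm_inverse (inverse_sym (runitK (ldual X))).
rewrite /ddual_tens /ddual_unit tensm_compl -2!compA (precomp L).
rewrite dual_tens_runit.
rewrite (compA (dualm (dual_tensi 𝟙 X))) (compA (dualm (dualm _))) K.
by rewrite (precomp1 r).
Qed.

Lemma ddual_tens_runit X :
  dualm (dualm (runit X)) \c ddual_tens X 𝟙
    \c (idm (ldual (ldual X)) ⊗m ddual_unit) =
  runit (ldual (ldual X)).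
Proof.
have L : dual_tens (ldual 𝟙) (ldual X)
      \c (idm (ldual (ldual X)) ⊗m dualm dual_uniti) =
    dualm (dual_uniti ⊗m idm (ldual X)) \c dual_tens 𝟙 (ldual X).
  by rewrite dual_tens_natural dualm1.
have i := inverse_comp (tensm_inverse dual_unitK (idm_inverse (ldual X)))
  (dual_tensK X 𝟙).
have I : (dual_uniti ⊗m idm (ldual X)) \c dual_tensi X 𝟙 \c dualm (runit X) =
    luniti (ldual X).
  rewrite -[RHS]comp1m; apply: esym.
  apply: inverse_square (lunitK _) i _.
  by rewrite compm1 dual_tens_runit.
have K : dualm (dualm (runit X))
      \c (dualm (dual_tensi X 𝟙) \c dualm (dual_uniti ⊗m idm (ldual X))) =
    dualm (luniti (ldual X)) by rewrite -!dualmM I.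
have [_ r] := dualm_inverse (inverse_sym (lunitK (ldual X))).
rewrite /ddual_tens /ddual_unit tensm_compr -2!compA (precomp L).
rewrite dual_tens_lunit.
rewrite (compA (dualm (dual_tensi X 𝟙))) (compA (dualm (dualm _))) K.
by rewrite (precomp1 r).
Qed.

Definition double_dual : monoidalFunctor C C.
Proof.
refine (@MonoidalFunctor k C C double_dual_functor ddual_tens ddual_unit
  _ _ _ _ _ _).
- move=> X Y; eexists; apply: inverse_comp (dual_tensK _ _) _.
  exact: dualm_inverse (inverse_sym (dual_tensK X Y)).
- eexists; apply: inverse_comp dual_unitK _.
  exact: dualm_inverse (inverse_sym dual_unitK).
- exact: ddual_tens_natural.
- exact: ddual_tens_assoc.
- exact: ddual_tens_lunit.
- exact: ddual_tens_runit.
Defined.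

Definition Piv : Type := Nat_tens (id_monoidal C) double_dual.

End DoubleDual.

Record tensorCategory (k : fieldType) := TensorCategory {
  tc_cat :> rigidCategory k;
  tc_abelian : is_abelian tc_cat;
  tc_simple_unit : is_simple (𝟙 : tc_cat);
  tc_finite_length : forall X : tc_cat, finite_length X;
  tc_finite_hom : forall X Y : tc_cat, fin_generated (hom X Y)
}.

(* Main.v *)
From HB Require Import structures.
From mathcomp Require Import all_boot all_algebra falgebra.
From mathcomp Require Import boolp.
Require Import Defs.

(** Why the theorem is true.

    A monoidal natural transformation behaves like a grouplike element, and
    grouplike elements are linearly independent.  Let F, G be monoidal functors
    into a tensor category and let eta_0, ..., eta_n be distinct monoidal
    natural transformations from F to G with a relation
    sum_i c_i eta_i = 0.  Evaluating the relation on Y ⊗ X gives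
    sum_i c_i eta_i(Y) ⊗ eta_i(X) = 0, whereas tensoring the relation at X with
    eta_0(Y) gives sum_i c_i eta_0(Y) ⊗ eta_i(X) = 0.  The difference
    sum_(i > 0) c_i (eta_i(Y) - eta_0(Y)) ⊗ eta_i(X) = 0 is a shorter relation,
    as in the proof of Dedekind's theorem on the independence of characters
    ([Nat_tens_lin_indep]).

    To conclude from it, one has to know that the tensor product of morphisms
    is injective: if the f_i : V -> W are linearly independent and
    sum_i g_i ⊗ f_i = 0, then every g_i vanishes ([tensm_sum_eq0]).  A right
    dual of W turns the f_i into linearly independent morphisms with values in
    the unit object 𝟙.  As 𝟙 is simple and its only endomorphisms are scalars
    ([schur_closed]; this is where the field has to be algebraically closed),
    the f_i can be separated: there is u such that f_j u is an epimorphism while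
    f_i u = 0 for i <> j ([separating_morphism]).  Tensoring with an object is a
    left adjoint and preserves epimorphisms, hence g_j ⊗ (f_j u) = 0 forces
    g_j = 0.

    The category being finite, it has a generator P, the object corresponding to
    the regular module.  A natural transformation from the identity is
    determined by its component at P, so the components at P of finitely many
    distinct pivotal structures are linearly independent in the
    finite-dimensional space Hom(P, P^** ), whose dimension bounds their number. *)

Set Implicit Arguments.
Unset Strict Implicit.
Unset Printing Implicit Defensive.

Import GRing.Theory.
Local Open Scope ring_scope.
Local Open Scope cat_scope.

(** * Linear independence and linear maps *)

Section LinearAlgebra.
Variable k : fieldType.

Section LinearMaps.
Variables (U V : lmodType k) (L : U -> V).
Hypothesis linL : linear L.

Let L' : {linear U -> V} := HB.pack L (GRing.isLinear.Build k U V *:%R L linL).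

Lemma linear_map0 : L 0 = 0.
Proof. exact: (raddf0 L'). Qed.

Lemma linear_mapD u v : L (u + v) = L u + L v.
Proof. exact: (raddfD L'). Qed.

Lemma linear_mapB u v : L (u - v) = L u - L v.
Proof. exact: (raddfB L'). Qed.

Lemma linear_mapZ a u : L (a *: u) = a *: L u.
Proof. by rewrite -[a *: u]addr0 linL linear_map0 addr0. Qed.

Lemma linear_map_comb n (c : 'I_n -> k) (u : 'I_n -> U) :
  L (\sum_i c i *: u i) = \sum_i c i *: L (u i).
Proof.
rewrite (big_morph L linear_mapD linear_map0).
by apply: eq_bigr => i _; exact: linear_mapZ.
Qed.

End LinearMaps.

Definition lin_indep (V : lmodType k) n (v : 'I_n -> V) : Prop :=
  forall c : 'I_n -> k, \sum_i c i *: v i = 0 -> forall i, c i = 0.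

Lemma lin_indep_image (U V : lmodType k) (L : U -> V) n (u : 'I_n -> U) :
  linear L -> injective L -> lin_indep u -> lin_indep (fun i => L (u i)).
Proof.
move=> linL injL indep c; rewrite -(linear_map_comb linL).
by rewrite -[RHS](linear_map0 linL) => /injL; exact: indep.
Qed.

Lemma fin_generated_bound (V : lmodType k) : fin_generated V ->
  exists N, forall n (v : 'I_n -> V), lin_indep v -> (n <= N)%N.
Proof.
case=> N [g gen]; exists N => n v indep; rewrite leqNgt; apply/negP => ltNn.
have [M vE] : exists M : 'I_n -> 'I_N -> k,
    forall i, v i = \sum_j M i j *: g j.
  by exists (fun i => sval (cid (gen (v i)))) => i; case: cid.
pose A := \matrix_(i, j) M i j : 'M[k]_(n, N).
have /rowV0Pn [u /sub_kermxP uA /negP[]] : kermx A != 0.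
  rewrite -mxrank_eq0 mxrank_ker subn_eq0 -ltnNge.
  exact: leq_ltn_trans (rank_leq_col A) ltNn.
apply/eqP/rowP => i; rewrite mxE; move: i; apply: indep.
under eq_bigr do rewrite vE scaler_sumr.
rewrite exchange_big big1 // => j _.
under eq_bigr do rewrite scalerA.
rewrite -scaler_suml.
suff -> : \sum_i u ord0 i * M i j = (u *m A) ord0 j by rewrite uA mxE scale0r.
by rewrite mxE; apply: eq_bigr => i _; rewrite mxE.
Qed.

End LinearAlgebra.

(** * Linear and abelian categories *)

Section LinearCategories.
Variables (k : fieldType) (C : linearCategory k).
Implicit Types X Y Z : C.

Lemma comp0m X Y Z (f : hom X Y) : 0 \c f = 0 :> hom X Z.
Proof. exact: (linear_map0 (comp_linearl f)). Qed.

Lemma compm0 X Y Z (g : hom Y Z) : g \c 0 = 0 :> hom X Z.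
Proof. exact: (linear_map0 (comp_linearr g)). Qed.

Lemma compBm X Y Z (g h : hom Y Z) (f : hom X Y) :
  (g - h) \c f = g \c f - h \c f.
Proof. exact: (linear_mapB (comp_linearl f)). Qed.

Lemma compmB X Y Z (g : hom Y Z) (f h : hom X Y) :
  g \c (f - h) = g \c f - g \c h.
Proof. exact: (linear_mapB (comp_linearr g)). Qed.

Lemma compZm X Y Z a (g : hom Y Z) (f : hom X Y) :
  (a *: g) \c f = a *: (g \c f).
Proof. exact: (linear_mapZ (comp_linearl f)). Qed.

Lemma compmZ X Y Z a (g : hom Y Z) (f : hom X Y) :
  g \c (a *: f) = a *: (g \c f).
Proof. exact: (linear_mapZ (comp_linearr g)). Qed.

Lemma comp_comb X Y Z n (c : 'I_n -> k) (g : 'I_n -> hom Y Z) (f : hom X Y) :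
  (\sum_i c i *: g i) \c f = \sum_i c i *: (g i \c f).
Proof. exact: (linear_map_comb (comp_linearl f)). Qed.

Lemma combm_comp X Y Z n (c : 'I_n -> k) (g : hom Y Z) (f : 'I_n -> hom X Y) :
  g \c (\sum_i c i *: f i) = \sum_i c i *: (g \c f i).
Proof. exact: (linear_map_comb (comp_linearr g)). Qed.

Lemma id0_zero_object X : idm X = 0 -> is_zero_object X.
Proof.
by move=> id0; split=> Y f g;
  [rewrite -[f]comp1m -[g]comp1m id0 !comp0m
  |rewrite -[f]compm1 -[g]compm1 id0 !compm0].
Qed.

Lemma epi_cancel0 X Y Z (f : hom X Y) (g : hom Y Z) :
  is_epi f -> g \c f = 0 -> g = 0.
Proof. by move=> epif gf0; apply: epif; rewrite gf0 comp0m. Qed.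

Lemma epi0P X Y (f : hom X Y) :
  (forall Z (g : hom Y Z), g \c f = 0 -> g = 0) -> is_epi f.
Proof.
move=> f0 Z g h gfhf; apply/subr0_eq/f0; by rewrite compBm gfhf subrr.
Qed.

Lemma kernel_mono X Y K (f : hom X Y) (i : hom K X) :
  is_kernel f i -> is_mono i.
Proof.
case=> fi0 univ Z g h igih.
have [|u [_ uniq_u]] := univ Z (i \c g); first by rewrite compA fi0 comp0m.
by rewrite -(uniq_u g) // (uniq_u h).
Qed.

Lemma iso_cancel0 X Y Z (f : hom Y Z) (g : hom X Y) :
  is_iso f -> f \c g = 0 -> g = 0.
Proof.
by case=> f' [f'f _] fg0; rewrite -[g]comp1m -f'f -compA fg0 compm0.
Qed.

Section Abelian.
Hypothesis abC : is_abelian C.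

(** A morphism that kills a nonzero f into S has a kernel through which f
    factors; this kernel is a nonzero subobject of S, hence all of S. *)
Lemma simple_epi X S (f : hom X S) : is_simple S -> f <> 0 -> is_epi f.
Proof.
move=> [_ simS] f0; apply: epi0P => Z g gf0.
have [_ _ kers _ _] := abC.
have [[K [i keri]] _] := kers _ _ g.
have [gi0 /(_ _ _ gf0) [h [fE _]]] := keri.
have [[K0 _]|[j [_ ij]]] := simS _ i (kernel_mono keri).
  by case: f0; rewrite -fE (K0 _ h 0) compm0.
by rewrite -[g]compm1 -ij compA gi0 comp0m.
Qed.

(** An epimorphism is the cokernel of some j; as j factors through the kernel i
    of f, whatever kills i kills j. *)
Lemma factor_through_simple X S Z (f : hom X S) K (i : hom K X) (g : hom X Z) :
  is_simple S -> f <> 0 -> is_kernel f i -> g \c i = 0 ->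
  exists h : hom S Z, g = h \c f.
Proof.
move=> simS f0 [_ kerf] gi0.
have [_ _ _ _ cok] := abC.
have [W [j [fj0 cokf]]] := cok _ _ f (simple_epi simS f0).
have [u [jE _]] := kerf _ _ fj0.
have [|h [hE _]] := cokf _ g; first by rewrite -jE compA gi0 comp0m.
by exists h.
Qed.

End Abelian.

Section Endomorphisms.
Variables (X : C) (phi : hom X X).

Definition endo_pow n : hom X X := iter n (comp phi) (idm X).

Lemma endo_powSr n : endo_pow n.+1 = endo_pow n \c phi.
Proof.
elim: n => [|n IHn]; first by rewrite /= compm1 comp1m.
by rewrite -[LHS]/(phi \c endo_pow n.+1) {1}IHn compA.
Qed.

Definition endo_poly (p : {poly k}) : hom X X :=
  \sum_(i < size p) p`_i *: endo_pow i.

Lemma endo_poly_widen n (p : {poly k}) : (size p <= n)%N ->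
  endo_poly p = \sum_(i < n) p`_i *: endo_pow i.
Proof.
move=> le_pn; rewrite /endo_poly.
rewrite (big_ord_widen n (fun i => p`_i *: endo_pow i)) //.
rewrite big_mkcond; apply: eq_bigr => i _; case: ltnP => // le_pi.
by rewrite nth_default // scale0r.
Qed.

(** The linear factor is on the right because this is the side on which an
    epimorphism can be cancelled. *)
Lemma endo_poly_XsubC_mul a (q : {poly k}) :
  endo_poly (('X - a%:P) * q) = endo_poly q \c (phi - a *: idm X).
Proof.
rewrite (@endo_poly_widen (size q).+1); last first.
  apply: leq_trans (size_polyMleq _ _) _; by rewrite size_XsubC.
rewrite compmB compmZ compm1.
rewrite {2}(endo_poly_widen (leqnSn (size q))).
rewrite {1}/endo_poly comp_comb scaler_sumr.
under eq_bigr do rewrite mulrBl coefB mul_polyC coefZ coefXM scalerBl -scalerA.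
rewrite sumrB; congr (_ - _).
rewrite big_ord_recl /= scale0r add0r.
by apply: eq_bigr => i _; rewrite -endo_powSr.
Qed.

End Endomorphisms.
End LinearCategories.

(** * Schur's lemma and separation of morphisms to a simple object *)

(** The powers of phi are linearly dependent, so p(phi) = 0 for some p <> 0,
    which splits into linear factors.  If no phi - a were zero, they would all be
    epimorphisms, and cancelling them would give idm S = 0. *)
Lemma schur_closed (k : closedFieldType) (C : linearCategory k) (S : C) :
  is_abelian C -> is_simple S -> fin_generated (hom S S) ->
  forall phi : hom S S, exists a, phi = a *: idm S.
Proof.
move=> abC simS fgS phi.
have idS : idm S <> 0 by move=> /id0_zero_object; case: simS.
have [N boundN] := fin_generated_bound fgS.
have [p p0 phip0] : exists2 p : {poly k}, p != 0 & endo_poly phi p = 0.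
  have : ~ lin_indep (fun i : 'I_N.+1 => endo_pow phi i).
    by move/boundN; rewrite ltnn.
  move/existsNP => [c /not_implyP [rel /existsNP [i /eqP ci0]]].
  pose p := \poly_(i < N.+1) c (inord i).
  exists p.
    apply: contraNneq ci0 => /(congr1 (fun q : {poly k} => q`_i)).
    by rewrite coef_poly ltn_ord inord_val coef0 => ->.
  rewrite (endo_poly_widen _ (size_poly _ _)) -[RHS]rel; apply: eq_bigr => j _.
  by rewrite coef_poly ltn_ord inord_val.
apply: contrapT => /forallNP not_scalar.
have epi_factor a : is_epi (phi - a *: idm S).
  by apply: simple_epi => // /subr0_eq; exact: not_scalar.
have [r pE] := closed_field_poly_normal p.
suff endo0 (q : {poly k}) :
    endo_poly phi (\prod_(a <- r) ('X - a%:P) * q) = 0 -> endo_poly phi q = 0.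
  have := endo0 (lead_coef p)%:P; rewrite mulrC mul_polyC -pE => /(_ phip0).
  rewrite /endo_poly size_polyC lead_coef_eq0 p0 big_ord1 coefC /= => /eqP.
  by rewrite scaler_eq0 lead_coef_eq0 (negPf p0) => /eqP.
elim: r {pE} => [|a r IHr]; first by rewrite big_nil mul1r.
rewrite big_cons -mulrA endo_poly_XsubC_mul.
by move/(epi_cancel0 (epi_factor a)).
Qed.

(** The categorical form of the fact that a linear form vanishing on the common
    kernel of f_0, ..., f_n lies in their span.  Restrict everything to the
    kernel of f_0: by induction g agrees there with a combination of the other
    f_j, and the difference factors through f_0, by a scalar. *)
Lemma span_of_kernels (k : fieldType) (C : linearCategory k) (S : C) :
  is_abelian C -> is_simple S ->
  (forall phi : hom S S, exists a, phi = a *: idm S) ->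
  forall n (X : C) (f : 'I_n -> hom X S) (g : hom X S),
    (forall K (i : hom K X), (forall j, f j \c i = 0) -> g \c i = 0) ->
    exists c : 'I_n -> k, g = \sum_j c j *: f j.
Proof.
move=> abC simS scal; elim=> [|n IHn] X f g van.
  (* With no f_j, the hypothesis applies to the identity of X. *)
  exists (fun=> 0); rewrite big_ord0 -[g]compm1; apply: van.
  by case.
have [_ _ kers _ _] := abC.
have [[K [i keri]] _] := kers _ _ (f ord0).
have [c cE] : exists c : 'I_n -> k,
    g \c i = \sum_j c j *: (f (lift ord0 j) \c i).
  apply: IHn => L u vanu; rewrite -compA; apply: van => j.
  case: (unliftP ord0 j) => [j' ->|->]; first by rewrite compA vanu.
  by rewrite compA (proj1 keri) comp0m.
pose g' := g - \sum_j c j *: f (lift ord0 j).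
have [a g'E] : exists a, g' = a *: f ord0.
  have g'i0 : g' \c i = 0 by rewrite compBm comp_comb cE subrr.
  have [f0|f0] := pselect (f ord0 = 0).
    (* The kernel of the zero morphism is an isomorphism. *)
    exists 0; rewrite scale0r -[g']compm1.
    have [|h [<- _]] := proj2 keri X (idm X); first by rewrite f0 comp0m.
    by rewrite compA g'i0 comp0m.
  have [h ->] := factor_through_simple abC simS f0 keri g'i0.
  by have [a ->] := scal h; exists a; rewrite compZm comp1m.
exists (fun j => if unlift ord0 j is Some j' then c j' else a).
rewrite big_ord_recl unlift_none -g'E addrC.
under eq_bigr do rewrite liftK.
by rewrite addrC subrK.
Qed.

(** * Injectivity of the tensor product of morphisms *)

Section TensorCategories.
Variables (k : closedFieldType) (D : tensorCategory k).
Implicit Types K V W X Y : D.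

Lemma separating_morphism n W (f : 'I_n -> hom W (𝟙 : D)) j :
  lin_indep f ->
  exists K (u : hom K W), (forall i, i != j -> f i \c u = 0) /\ f j \c u <> 0.
Proof.
move=> indep; apply: contrapT => none.
(* Replacing f j by 0 leaves the family of the other f i; a relation expressing
   f j by them contradicts independence, its coefficient at j being -1. *)
pose f' i := if i == j then 0 else f i.
have [|c fjE] := span_of_kernels (tc_abelian D) (tc_simple_unit D)
    (schur_closed (tc_abelian D) (tc_simple_unit D) (tc_finite_hom _ _))
    (f := f') (g := f j).
  move=> K u vanu; apply: contrapT => fju; apply: none; exists K, u; split=> // i.
  by move=> /negPf ij; have := vanu i; rewrite /f' ij.
have rel : \sum_i (if i == j then -1 else c i) *: f i = 0.
  rewrite (bigD1 j) //= eqxx scaleN1r {1}fjE (bigD1 j) //= /f' eqxx scaler0 add0r.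
  rewrite addrC; apply/eqP; rewrite subr_eq0; apply/eqP.
  by apply: eq_bigr => i /negPf ->.
by have := indep _ rel j; rewrite eqxx => /eqP; rewrite oppr_eq0 oner_eq0.
Qed.

(** A right dual Y of X makes X ⊗ - left adjoint to Y ⊗ -, and left adjoints
    preserve epimorphisms. *)
Lemma tensm_epi X V W (f : hom V W) : is_epi f -> is_epi (idm X ⊗m f).
Proof.
move=> epif Z g h gfhf.
have [Y [e [c /duality_zigzag [_ z2]]]] := right_rigid X.
have adj (u : hom (X ⊗ W) Z) :
    u = contract e Z \c (idm X ⊗m ((idm Y ⊗m u) \c insert c W)).
  by rewrite tensm_compr compA contract_natural -compA z2 compm1.
rewrite [g]adj [h]adj; congr (_ \c (_ ⊗m _)); apply: epif.
rewrite -(compA (idm Y ⊗m g)) -(compA (idm Y ⊗m h)) -insert_natural.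
by rewrite (compA (idm Y ⊗m g)) (compA (idm Y ⊗m h)) -!tensm_compr gfhf.
Qed.

Lemma tensm0 X X' Y Y' (f : hom X X') :
  f ⊗m (0 : hom Y Y') = 0 :> hom (X ⊗ Y : D) _.
Proof. exact: (linear_map0 (tensm_linearr f)). Qed.

Lemma tens0m X X' Y Y' (f : hom Y Y') :
  (0 : hom X X') ⊗m f = 0 :> hom (X ⊗ Y : D) _.
Proof. exact: (linear_map0 (tensm_linearl f)). Qed.

Lemma tensm_sum_eq0_unit n X Y W (f : 'I_n -> hom W (𝟙 : D))
    (g : 'I_n -> hom X Y) :
  lin_indep f -> \sum_i (g i ⊗m f i) = 0 -> forall i, g i = 0.
Proof.
move=> indep sum0 j.
have [K [u [fu0 /(simple_epi (tc_abelian D) (tc_simple_unit D)) epifu]]] :=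
  separating_morphism j indep.
apply: tensm1_inj; rewrite tens0m.
apply: epi_cancel0 (tensm_epi (X := X) epifu) _.
rewrite -tensmM compm1 comp1m.
have := congr1 (fun w => w \c (idm X ⊗m u)) sum0; rewrite comp0m => <-.
rewrite (big_morph (fun w => w \c _) (linear_mapD (comp_linearl _)) (comp0m _ _)).
rewrite (bigD1 j) //= big1 => [|i ij]; last by rewrite -tensmM fu0 ?tensm0.
by rewrite addr0 -tensmM compm1.
Qed.

(** A right dual R of W reduces the general case to morphisms into 𝟙: the
    transpose V ⊗ R -> 𝟙 of f_i determines f_i, and the transposes inherit
    the relation. *)
Lemma tensm_sum_eq0 n X Y V W (f : 'I_n -> hom V W) (g : 'I_n -> hom X Y) :
  lin_indep f -> \sum_i (g i ⊗m f i) = 0 -> forall i, g i = 0.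
Proof.
move=> indep sum0.
have [R [e [c dual]]] := right_rigid W.
pose bend (u : hom V W) := e \c (u ⊗m idm R).
have bendL : linear bend.
  by move=> a u v; rewrite /bend tensm_linearl comp_linearr.
have bendI : injective bend by move=> u v; exact: ev_inj dual.
apply: (tensm_sum_eq0_unit (lin_indep_image bendL bendI indep)).
have bendE i : g i ⊗m bend (f i) =
    (idm Y ⊗m e) \c assoc Y W R \c ((g i ⊗m f i) ⊗m idm R) \c associ X V R.
  rewrite -!compA (compA (assoc Y W R)) assoc_natural -compA.
  by rewrite (proj2 (assocK _ _ _)) compm1 -tensmM comp1m.
have cutL : linear (fun w : hom (X ⊗ V) (Y ⊗ W) =>
    (idm Y ⊗m e) \c assoc Y W R \c (w ⊗m idm R) \c associ X V R).
  by move=> a u v; rewrite tensm_linearl comp_linearr comp_linearl.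
under eq_bigr do rewrite bendE.
rewrite -(big_morph _ (linear_mapD cutL) (linear_map0 cutL)) sum0.
exact: linear_map0 cutL.
Qed.

End TensorCategories.

(** * Linear independence of monoidal natural transformations *)

Lemma Nat_tens_ext (k : fieldType) (C D : monoidalCategory k)
    (F G : monoidalFunctor C D) (eta theta : Nat_tens F G) :
  (forall X, eta X = theta X) -> eta = theta.
Proof.
case: eta theta => [eta a b c] [theta a' b' c'] /= eta_theta.
have e := functional_extensionality_dep eta_theta.
case: theta / e a' b' c' {eta_theta} => a' b' c'.
by congr NatTens; exact: Prop_irrelevance.
Qed.

(** Dedekind's argument.  The hypothesis on P lets the relation at P spread to
    all objects, so that it can be evaluated at the products Y ⊗ P; the
    remaining coefficient is handled at 𝟙, where a monoidal transformation does
    not vanish. *)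
Lemma Nat_tens_lin_indep (k : closedFieldType) (C : monoidalCategory k)
    (D : tensorCategory k) (F G : monoidalFunctor C D) (P : C) :
  (forall xi : forall X, hom (F X) (G X),
     is_natural xi -> xi P = 0 -> forall X, xi X = 0) ->
  forall n (eta : 'I_n -> Nat_tens F G),
    injective eta -> lin_indep (fun i => eta i P).
Proof.
move=> detP; elim=> [|n IHn] eta eta_inj c relP i; first by case: i.
have rel X : \sum_j c j *: eta j X = 0.
  apply: (detP (fun X => \sum_j c j *: eta j X)) => // {}X Y f.
  rewrite comp_comb combm_comp; apply: eq_bigr => j _.
  by rewrite (nt_natural (eta j)).
have relM X Y : \sum_j c j *: (eta j Y ⊗m eta j X) = 0.
  apply: (iso_cancel0 (mf2_iso G Y X)); rewrite combm_comp.
  under eq_bigr do rewrite -nt_tens.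
  by rewrite -comp_comb rel comp0m.
have indep : lin_indep (fun j => eta (lift ord0 j) P).
  by apply: IHn => j j' /eta_inj; exact: lift_inj.
have tail0 j : c (lift ord0 j) = 0.
  apply: contrapT => cj0.
  suff /eta_inj /eqP : eta (lift ord0 j) = eta ord0.
    by rewrite eq_sym (negPf (neq_lift _ _)).
  apply: Nat_tens_ext => Y; apply/subr0_eq.
  have diff0 : \sum_j ((c (lift ord0 j) *: (eta (lift ord0 j) Y - eta ord0 Y))
      ⊗m eta (lift ord0 j) P) = 0.
    have Ly := tensm_linearr (Y := F P) (Y' := G P) (eta ord0 Y).
    have := congr1 (fun u => eta ord0 Y ⊗m u) (rel P).
    rewrite (linear_map_comb Ly) (linear_map0 Ly) => rel0.
    have rel2 : \sum_j c j *: (eta j Y ⊗m eta j P)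
        - \sum_j c j *: (eta ord0 Y ⊗m eta j P) = 0 by rewrite relM rel0 subrr.
    rewrite -[RHS]rel2 -sumrB big_ord_recl subrr add0r; apply: eq_bigr => l _.
    have Ll := tensm_linearl (X := F Y) (X' := G Y) (eta (lift ord0 l) P).
    by rewrite (linear_mapZ Ll) (linear_mapB Ll) scalerBr.
  have := tensm_sum_eq0 indep diff0 j.
  by move/eqP; rewrite scaler_eq0 => /orP [/eqP|/eqP].
case: (unliftP ord0 i) => [j ->|-> {i}]; first exact: tail0.
have := rel 𝟙; rewrite big_ord_recl big1 ?addr0 => [|j _]; last first.
  by rewrite tail0 scale0r.
move/eqP; rewrite scaler_eq0 => /orP [/eqP //|/eqP eta0].
have [not0 _] := tc_simple_unit D; case: not0; apply: id0_zero_object.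
apply: (iso_cancel0 (mf0_iso G)).
by rewrite compm1 -(nt_unit (eta ord0)) eta0 comp0m.
Qed.

(** * Generators of a finite category *)

(** Morphisms from P jointly detect equality.  For finitely generated
    modules this says that every object is a quotient of a finite direct sum of
    copies of P; the present form needs no direct sums. *)
Definition is_generator (k : fieldType) (C : linearCategory k) (P : C) : Prop :=
  forall X Z (g h : hom X Z), (forall p : hom P X, g \c p = h \c p) -> g = h.

Section Generators.
Variable k : fieldType.

Lemma unit_iso_faithful (C D : linearCategory k) (H : linearFunctor C D)
    (K : linearFunctor D C)
    (eta : forall X, hom (id_functor C X) (comp_functor K H X)) :
  is_natural_iso eta ->
  forall X Y (f g : hom X Y), fmap H f = fmap H g -> f = g.
Proof.
move=> [nat iso] X Y f g fg; have [eta' etaK] := iso Y.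
apply: (iso_mono etaK).
by rewrite -[f]/(fmap (id_functor C) f) -[g]/(fmap (id_functor C) g) !nat /= fg.
Qed.

Lemma counit_iso_faithful (C D : linearCategory k) (H : linearFunctor C D)
    (K : linearFunctor D C)
    (eps : forall X, hom (comp_functor K H X) (id_functor C X)) :
  is_natural_iso eps ->
  forall X Y (f g : hom X Y), fmap H f = fmap H g -> f = g.
Proof.
move=> [nat iso] X Y f g fg; have [eps' epsK] := iso X.
apply: (iso_epi epsK).
by rewrite -[f]/(fmap (id_functor C) f) -[g]/(fmap (id_functor C) g) -!nat /= fg.
Qed.

(** With q : P -> H X, the morphism to test with is the adjunct
    K P -> K (H X) -> X of q; naturality and the faithfulness of both functors
    bring the equality back to g and h. *)
Lemma generator_equivalence (C D : linearCategory k) (P : D) :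
  linearly_equivalent C D -> is_generator P -> exists Q : C, is_generator Q.
Proof.
move=> [H [K [eta [eps [isoeta isoeps]]]]] genP; exists (K P) => X Z g h eqgh.
apply: (unit_iso_faithful isoeta); apply: genP => q.
apply: (counit_iso_faithful isoeps); rewrite !fmapM.
have [nat iso] := isoeta; have [etaX' etaXK] := iso X.
have := congr1 (fun u => eta Z \c u) (eqgh (etaX' \c fmap K q)).
have natE (u : hom X Z) : eta Z \c u = fmap K (fmap H u) \c eta X := nat X Z u.
rewrite !compA !natE -!(compA _ (eta X)) (proj2 etaXK).
by rewrite !compm1.
Qed.

(** The regular module is a generator, x in X being the image of 1 under
    a |-> a x. *)
Lemma fgModule_generator (A : falgType k) :
  exists P : fgModule_category A, is_generator P.
Proof.
have fgA : fin_generated (A^o : lmodType A).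
  exists 1, (fun=> 1) => a; exists (fun=> a); rewrite big_ord1.
  by rewrite /GRing.scale /= mulr1.
exists (FgModule fgA) => X Z g h eqgh; apply: modHomP => x.
have linp : linear (fun a : A^o => (a : A) *: x : X).
  by move=> a b c; rewrite scalerDl scalerA.
pose p : modHom A^o X := HB.pack (fun a : A^o => (a : A) *: x : X)
  (GRing.isLinear.Build A A^o X *:%R _ linp).
have := congr1 (fun u : modHom A^o Z => u 1) (eqgh p).
by rewrite /= !scale1r.
Qed.

Lemma natural_detect (C : linearCategory k) (P : C) (G : linearFunctor C C)
    (xi : forall X, hom (id_functor C X) (G X)) :
  is_generator P -> is_natural xi -> xi P = 0 -> forall X, xi X = 0.
Proof.
move=> genP nat xiP0 X; apply: genP => p; rewrite comp0m.
by have := nat P X p; rewrite xiP0 compm0.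
Qed.

End Generators.

(** * Finiteness *)

(** An injection from the largest possible ['I_n] is onto: a value outside its
    image would extend it to ['I_n.+1]. *)
Lemma finite_type_of_bound (T : Type) N :
  (forall n (f : 'I_n -> T), injective f -> (n <= N)%N) -> is_finite_type T.
Proof.
move=> bound.
pose has_inj n := `[< exists f : 'I_n -> T, injective f >].
have ex0 : exists n, has_inj n.
  exists 0; apply/asboolP.
  by exists (fun i : 'I_0 => False_rect T (notF (ltn_ord i))); case.
have le_N n : has_inj n -> (n <= N)%N by move/asboolP=> [f]; exact: bound.
case: (ex_maxnP ex0 le_N) => n /asboolP [f f_inj] max_n.
have f_surj t : exists i, f i = t.
  apply: contrapT => /forallNP not_t.
  have /max_n : has_inj n.+1; last by rewrite ltnn.
  apply/asboolP; exists (fun i => oapp f t (unlift ord0 i)) => i j.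
  case: (unliftP ord0 i) => [i' ->|->]; case: (unliftP ord0 j) => [j' ->|->];
    rewrite ?liftK ?unlift_none //=.
  - by move/f_inj ->.
  - by move/not_t.
  - by move/esym/not_t.
exists n, f, (fun t => sval (cid (f_surj t))) => [i|t]; last by case: cid.
by apply: f_inj; case: cid.
Qed.

Theorem corollary1p4 (k : closedFieldType) (C : tensorCategory k)
  (hC : is_finite_category C) : is_finite_type (Piv C).
Proof.
have [A CA] := hC; have [PA genA] := fgModule_generator A.
have [P genP] := generator_equivalence CA genA.
have [N boundN] := fin_generated_bound (tc_finite_hom P (ldual (ldual P))).
apply: (@finite_type_of_bound _ N) => n eta eta_inj.
apply: (boundN _ (fun i => eta i P)).
by apply: Nat_tens_lin_indep eta_inj => xi; exact: natural_detect.
Qed.
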